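(* Let $\langle A,N\rangle$ be a $C^2_\omega$-structure whose underlying algebra $A$ is a complete Boolean algebra, and let $\|\cdot\|$ be any fixed interpretation mapping of the sentences of the language in $A$ (as in the context). Then all set-theoretic axioms of $ZF_{C^2_\omega}$ (Extensionality, Pairing, Collection, Powerset, Separation, Empty set, Union, Infinity, Regularity), and also the Axiom of Choice (AC), are valid in $\mathbf{V}^{\langle A,N\rangle}$.
   Context: A $C^2_\omega$-structure over a complete Boolean algebra $A$ is a pair $\langle A,N\rangle$, $N=\{N_x\}_{x\in A}$ a family of subsets of $A$, such that for all $x\in A$ and $x'\in N_x$: $x\vee x'=1$, and there is $x''\in N_{x'}$ with $x''\le x$. Fix a model $\mathbf{V}$ of set theory. By transfinite recursion, $\mathbf{V}_\xi=\{x: x\text{ is a function},\ \mathrm{ran}(x)\subseteq A,\ \mathrm{dom}(x)\subseteq\mathbf{V}_\zeta\text{ for some }\zeta<\xi\}$, and $\mathbf{V}^{\langle A,N\rangle}$ is the class of all $x$ belonging to some $\mathbf{V}_\xi$. The language is first-order with connectives $\to,\wedge,\vee,\neg,\bot$, quantifiers, binary predicates $\in,\approx$, and a constant for each element of $\mathbf{V}^{\langle A,N\rangle}$; $\alpha\leftrightarrow\beta$ is $(\alpha\to\beta)\wedge(\beta\to\alpha)$, $\exists x\in u\,\varphi$ is $\exists x(x\in u\wedge\varphi)$, $\forall x\in u\,\varphi$ is $\forall x(x\in u\to\varphi)$. An interpretation mapping is a mapping $\|\cdot\|$ from the sentences to $A$ such that: $\|\bot\|=0$; $\|u\in v\|=\bigvee_{x\in\mathrm{dom}(v)}(v(x)\wedge\|x\approx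 u\|)$; $\|u\approx v\|=\bigwedge_{x\in\mathrm{dom}(u)}(u(x)\to\|x\in v\|)\wedge\bigwedge_{x\in\mathrm{dom}(v)}(v(x)\to\|x\in u\|)$; $\|\neg\varphi\|\in N_{\|\varphi\|}$; $\|\varphi\#\psi\|=\|\varphi\|\#\|\psi\|$ for $\#\in\{\wedge,\vee,\to\}$; $\|u\approx v\|\le\|\neg\phi(u)\|\to\|\neg\phi(v)\|$ for every formula $\phi(x)$ with at most $x$ free; $\|\exists x\varphi\|=\bigvee_{u}\|\varphi(u)\|$ and $\|\forall x\varphi\|=\bigwedge_{u}\|\varphi(u)\|$, $u$ ranging over $\mathbf{V}^{\langle A,N\rangle}$. A sentence $\varphi$ is valid in $\mathbf{V}^{\langle A,N\rangle}$ if $\|\varphi\|=1$. The set-theoretic axioms (schemas range over all formulas $\phi$ of the language, possibly containing $\neg$) are: Extensionality: $\forall x\forall y[\forall z(z\in x\leftrightarrow z\in y)\to x\approx y]$. Pairing: $\forall x\forall y\exists w\forall z[z\in w\leftrightarrow(z\approx x\vee z\approx y)]$. Collection: $\forall x[(\forall y\in x\,\exists z\,\phi(y,z))\to\exists w\,\forall y\in x\,\exists z\in w\,\phi(y,z)]$, $w$ not free in $\phi$. Powerset: $\forall x\exists w\forall z[z\in w\leftrightarrow\forall y\in z(y\in x)]$. Separation: $\forall x\exists w\forall z[z\in w\leftrightarrow(z\in x\wedge\phi(z))]$, $w$ not free in $\phi$. Empty set: $\exists x\forall z[z\in x\leftrightarrow((z\approx z)\to\bot)]$ (the unique such set is denoted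 $\emptyset$). Union: $\forall x\exists w\forall z[z\in w\leftrightarrow\exists y\in x(z\in y)]$. Infinity: $\exists x[\emptyset\in x\wedge\forall y\in x(y^+\in x)]$, where $y^+=y\cup\{y\}$. Regularity (Induction): $\forall x[(\forall y\in x\,\phi(y))\to\phi(x)]\to\forall x\,\phi(x)$, $y$ not free in $\phi(x)$. (AC): $\forall u\exists f[\mathrm{Fun}(f)\wedge\mathrm{dom}(f)\approx u\wedge\forall x\in u(((x\approx\emptyset)\to\bot)\to f(x)\in x)]$, where $\mathrm{Fun}(f)$ says that $f$ is a set of ordered pairs that is a function, and $\mathrm{dom}(f)$ is its domain. *)

(* Defs.v *)
From HB Require Import structures.
From mathcomp Require Import all_boot all_order.
From mathcomp Require Import classical_sets.
Set Implicit Arguments.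
Unset Strict Implicit.
Unset Printing Implicit Defensive.
Import Order.TTheory.
Local Open Scope order_scope.

(* The ground model V. Interpretation mappings are arbitrary functions on the
   proper class of sentences and must count as classes of V, so Separation and
   Replacement are stated for arbitrary predicates on V. *)
Record ZFC_model := ZFCModel {
  universe :> Type;
  inV : universe -> universe -> Prop;
  ZFC_extensionality : forall a b, (forall z, inV z a <-> inV z b) -> a = b;
  ZFC_pairing : forall a b, exists p, forall z, inV z p <-> z = a \/ z = b;
  ZFC_union : forall a, exists u, forall z,
    inV z u <-> exists2 y, inV y a & inV z y;
  ZFC_powerset : forall a, exists p, forall z,
    inV z p <-> forall y, inV y z -> inV y a;
  ZFC_infinity : exists w,
    (exists2 e, inV e w & forall z, ~ inV z e) /\
    (forall x, inV x w ->
       exists2 s, inV s w & forall z, inV z s <-> inV z x \/ z = x);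
  ZFC_separation : forall (P : universe -> Prop) a, exists b, forall z,
    inV z b <-> inV z a /\ P z;
  ZFC_replacement : forall (R : universe -> universe -> Prop) a,
    (forall x y y', inV x a -> R x y -> R x y' -> y = y') ->
    exists b, forall y, inV y b <-> exists2 x, inV x a & R x y;
  ZFC_foundation : forall a, (exists x, inV x a) ->
    exists2 x, inV x a & forall y, inV y x -> ~ inV y a;
  ZFC_choice : forall a,
    (forall x, inV x a -> exists z, inV z x) ->
    (forall x y z, inV x a -> inV y a -> inV z x -> inV z y -> x = y) ->
    exists c, forall x, inV x a ->
      exists z, forall t, (inV t x /\ inV t c) <-> t = z
}.
Arguments inV {z}.

Section SetsOfTheModel.
Variable V : ZFC_model.
Implicit Types a b f p u x xi zeta : V.

Definition is_pair p a b := forall z, inV z p <-> z = a \/ z = b.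

Definition is_opair p a b :=
  exists s t, [/\ is_pair s a a, is_pair t a b & is_pair p s t].

(* f(u) is defined and equal to a *)
Definition maps f u a := exists2 p, is_opair p u a & inV p f.

Definition is_function f :=
  (forall p, inV p f -> exists u a, is_opair p u a) /\
  (forall u a b, maps f u a -> maps f u b -> a = b).

Definition is_transitive x := forall y z, inV y x -> inV z y -> inV z x.

Definition is_ordinal x :=
  is_transitive x /\ (forall y, inV y x -> is_transitive y).

End SetsOfTheModel.

(* A is a set of V: its elements are identified, via the injection code, with
   the elements of some set of V. *)
Definition set_coding (V : ZFC_model) (A : Type) (code : A -> V) :=
  injective code /\ exists s, forall w, inV w s <-> exists a, w = code a.

Section Names.
Variables (V : ZFC_model) (A : Type) (code : A -> V).

(* in_stage xi x is x \in V_xi; the transfinite recursion on xi is rendered as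
   an inductive predicate. *)
Inductive in_stage (xi x : V) : Prop :=
  InStage (zeta : V) of
    inV zeta xi & is_function x &
    (forall u w, maps x u w -> exists a, w = code a) &
    (forall u w, maps x u w -> in_stage zeta u).

Definition is_name (x : V) := exists2 xi, is_ordinal xi & in_stage xi x.

Definition name := {x : V | is_name x}.

Definition name_maps (u x : name) (a : A) := maps (sval u) (sval x) (code a).

End Names.

(* First-order formulas with named variables, so that interpretation mappings
   need not identify alphabetic variants. C is the type of constants. *)
Section Formulas.
Variable C : Type.

Inductive term := Var of nat | Cst of C.

Inductive formula :=
  | Bot
  | Elem of term & term
  | Eqv of term & term
  | And of formula & formula
  | Or of formula & formula
  | Imp of formula & formula
  | Neg of formula
  | All of nat & formula
  | Ex of nat & formula.

Definition tfree (x : nat) (t : term) := if t is Var y then x == y else false.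

Fixpoint free (x : nat) (phi : formula) : bool :=
  match phi with
  | Bot => false
  | Elem s t | Eqv s t => tfree x s || tfree x t
  | And p q | Or p q | Imp p q => free x p || free x q
  | Neg p => free x p
  | All y p | Ex y p => (x != y) && free x p
  end.

Definition sentence (phi : formula) := forall x, ~~ free x phi.

Definition tsubst (x : nat) (r t : term) := if tfree x t then r else t.

(* Replacement of the free occurrences of x by r. It does not rename bound
   variables: no capture can occur when r is a constant, and substitution of a
   variable is only used under the proviso free_for. *)
Fixpoint subst (x : nat) (r : term) (phi : formula) : formula :=
  match phi with
  | Bot => Bot
  | Elem s t => Elem (tsubst x r s) (tsubst x r t)
  | Eqv s t => Eqv (tsubst x r s) (tsubst x r t)
  | And p q => And (subst x r p) (subst x r q)
  | Or p q => Or (subst x r p) (subst x r q)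
  | Imp p q => Imp (subst x r p) (subst x r q)
  | Neg p => Neg (subst x r p)
  | All y p => All y (if x == y then p else subst x r p)
  | Ex y p => Ex y (if x == y then p else subst x r p)
  end.

Fixpoint free_for (y x : nat) (phi : formula) : bool :=
  match phi with
  | Bot | Elem _ _ | Eqv _ _ => true
  | And p q | Or p q | Imp p q => free_for y x p && free_for y x q
  | Neg p => free_for y x p
  | All z p | Ex z p =>
      ~~ free x (All z p) || (y != z) && free_for y x p
  end.

Definition Iff p q := And (Imp p q) (Imp q p).
Definition AllIn x t p := All x (Imp (Elem (Var x) t) p).
Definition ExIn x t p := Ex x (And (Elem (Var x) t) p).
Definition Foralls (xs : seq nat) p := foldr All p xs.

End Formulas.

Arguments Var {C}.
Arguments Bot {C}.

Declare Scope fm_scope.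
Delimit Scope fm_scope with fm.
Bind Scope fm_scope with formula.
Notation "x '∈' y" := (Elem x y) (at level 70, no associativity) : fm_scope.
Notation "x '≈' y" := (Eqv x y) (at level 70, no associativity) : fm_scope.
Notation "p '⋏' q" := (And p q) (at level 80, right associativity) : fm_scope.
Notation "p '⋎' q" := (Or p q) (at level 85, right associativity) : fm_scope.
Notation "p '⇒' q" := (Imp p q) (at level 90, right associativity) : fm_scope.
Notation "p '⇔' q" := (Iff p q) (at level 95, no associativity) : fm_scope.

Section SetTheory.
Variable C : Type.
Local Open Scope fm_scope.
Local Coercion Var : nat >-> term.
Implicit Types (phi : formula C) (w x y z : nat) (xs : seq nat).

(* The abbreviations below take variables < 20 as arguments from the axioms;
   the variables they bind themselves are >= 20, chosen so that none is
   captured when they are nested. *)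

Definition EmptyF x : formula C := All 20 (20 ∈ x ⇔ (20 ≈ 20 ⇒ Bot)).

(* x is y^+ *)
Definition SuccF x y : formula C := All 20 (20 ∈ x ⇔ (20 ∈ y ⋎ 20 ≈ y)).

(* p is {x, y} *)
Definition PairF p x y : formula C := All 20 (20 ∈ p ⇔ (20 ≈ x ⋎ 20 ≈ y)).

(* p is {{x}, {x, y}} *)
Definition OPairF p x y : formula C :=
  Ex 21 (Ex 22 (PairF 21 x x ⋏ PairF 22 x y ⋏ PairF p 21 22)).

(* <x, y> \in f *)
Definition AppF f x y : formula C := Ex 23 (23 ∈ f ⋏ OPairF 23 x y).

Definition FunF f : formula C :=
  AllIn 24 f (Ex 25 (Ex 26 (OPairF 24 25 26))) ⋏
  All 24 (All 25 (All 26 (AppF f 24 25 ⋏ AppF f 24 26 ⇒ 25 ≈ 26))).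

(* d is dom(f) *)
Definition DomF d f : formula C := All 24 (24 ∈ d ⇔ Ex 25 (AppF f 24 25)).

Definition Extensionality : formula C :=
  All 0 (All 1 (All 2 (2 ∈ 0 ⇔ 2 ∈ 1) ⇒ 0 ≈ 1)).

Definition Pairing : formula C :=
  All 0 (All 1 (Ex 2 (All 3 (3 ∈ 2 ⇔ (3 ≈ 0 ⋎ 3 ≈ 1))))).

Definition Collection x y z w phi : formula C :=
  All x (AllIn y x (Ex z phi) ⇒ Ex w (AllIn y x (ExIn z w phi))).

Definition Powerset : formula C :=
  All 0 (Ex 1 (All 2 (2 ∈ 1 ⇔ AllIn 3 2 (3 ∈ 0)))).

Definition Separation x w z phi : formula C :=
  All x (Ex w (All z (z ∈ w ⇔ (z ∈ x ⋏ phi)))).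

Definition EmptySet : formula C := Ex 0 (All 1 (1 ∈ 0 ⇔ (1 ≈ 1 ⇒ Bot))).

Definition Union : formula C :=
  All 0 (Ex 1 (All 2 (2 ∈ 1 ⇔ ExIn 3 0 (2 ∈ 3)))).

(* The defined terms of Infinity and AC (the empty set, y^+, dom(f), f(x)) are
   eliminated in favour of existential quantification over the sets satisfying
   their definitions. *)
Definition Infinity : formula C :=
  Ex 0 (Ex 1 (EmptyF 1 ⋏ 1 ∈ 0) ⋏
        AllIn 2 0 (Ex 3 (SuccF 3 2 ⋏ 3 ∈ 0))).

Definition Regularity x y phi : formula C :=
  All x (AllIn y x (subst x y phi) ⇒ phi) ⇒ All x phi.

Definition ACSentence : formula C :=
  All 0 (Ex 1 (
    FunF 1 ⋏
    Ex 2 (DomF 2 1 ⋏ 2 ≈ 0) ⋏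
    AllIn 3 0 ((Ex 4 (EmptyF 4 ⋏ 3 ≈ 4) ⇒ Bot) ⇒
               Ex 5 (AppF 1 3 5 ⋏ 5 ∈ 3)))).

(* The schemas range over all formulas phi, possibly with constants and with
   further free variables; the axioms are the universal closures. *)
Inductive ZF_axiom : formula C -> Prop :=
  | AxExtensionality : ZF_axiom Extensionality
  | AxPairing : ZF_axiom Pairing
  | AxCollection xs x y z w phi :
      uniq [:: x; y; z; w] -> ~~ free w phi ->
      sentence (Foralls xs (Collection x y z w phi)) ->
      ZF_axiom (Foralls xs (Collection x y z w phi))
  | AxPowerset : ZF_axiom Powerset
  | AxSeparation xs x w z phi :
      uniq [:: x; w; z] -> ~~ free w phi ->
      sentence (Foralls xs (Separation x w z phi)) ->
      ZF_axiom (Foralls xs (Separation x w z phi))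
  | AxEmptySet : ZF_axiom EmptySet
  | AxUnion : ZF_axiom Union
  | AxInfinity : ZF_axiom Infinity
  | AxRegularity xs x y phi :
      x != y -> ~~ free y phi -> free_for y x phi ->
      sentence (Foralls xs (Regularity x y phi)) ->
      ZF_axiom (Foralls xs (Regularity x y phi)).

End SetTheory.

(* Completeness: every subset has a least upper bound (hence also a greatest
   lower bound). *)
Definition complete d (A : porderType d) :=
  forall S : set A, exists s, supremums S s.

Section Interpretation.
Variables (d : Order.disp_t) (A : ctbDistrLatticeType d).

Definition bimp (a b : A) : A := ~` a `|` b.

Definition Sup (S : set A) : A := supremum \bot S.
Definition Inf (S : set A) : A := infimum \top S.

Definition C2omega_structure (N : A -> set A) :=
  forall x x', N x x' ->
    x `|` x' = \top /\ exists x'', N x' x'' /\ x'' <= x.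

Variables (V : ZFC_model) (code : A -> V) (N : A -> set A).
Local Notation cst := (@Cst (name code)).

(* An interpretation mapping is only constrained on sentences; its values on
   the other formulas are irrelevant. *)
Record interpretation (I : formula (name code) -> A) : Prop := {
  int_bot : I Bot = \bot;
  int_mem : forall u v : name code,
    I (Elem (cst u) (cst v)) =
    Sup (fun b => exists x a, name_maps v x a /\
                    b = a `&` I (Eqv (cst x) (cst u)));
  int_eqv : forall u v : name code,
    I (Eqv (cst u) (cst v)) =
    Inf (fun b => exists x a, name_maps u x a /\
                    b = bimp a (I (Elem (cst x) (cst v)))) `&`
    Inf (fun b => exists x a, name_maps v x a /\
                    b = bimp a (I (Elem (cst x) (cst u))));
  int_neg : forall phi, sentence phi -> N (I phi) (I (Neg phi));
  int_and : forall phi psi, sentence phi -> sentence psi ->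
    I (And phi psi) = I phi `&` I psi;
  int_or : forall phi psi, sentence phi -> sentence psi ->
    I (Or phi psi) = I phi `|` I psi;
  int_imp : forall phi psi, sentence phi -> sentence psi ->
    I (Imp phi psi) = bimp (I phi) (I psi);
  int_leibniz : forall (u v : name code) x phi, sentence (All x phi) ->
    I (Eqv (cst u) (cst v)) <=
    bimp (I (Neg (subst x (cst u) phi))) (I (Neg (subst x (cst v) phi)));
  int_ex : forall x phi, sentence (Ex x phi) ->
    I (Ex x phi) = Sup (range (fun u => I (subst x (cst u) phi)));
  int_all : forall x phi, sentence (All x phi) ->
    I (All x phi) = Inf (range (fun u => I (subst x (cst u) phi)))
}.

Definition valid (I : formula (name code) -> A) phi := I phi = \top.

End Interpretation.

(* Main.v *)
Require Import Defs.
From mathcomp Require Import all_boot all_order.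
From mathcomp Require Import classical_sets.
From mathcomp Require Import boolp wochoice.

(** The names form an ordinary Boolean-valued universe: the clauses for
    membership and equality are the usual ones, and negation is a further unary
    connective that interacts with them only through the Leibniz law, which is
    stipulated for negated formulas. An induction on formulas extends this law
    to the whole language ([force_leibniz]), and this is all that the classical
    verification of the axioms asks of the formulas in the schemas.

    Truth values are handled as in forcing: an element [h] of the algebra is a
    condition, and [h <= ev e phi] says that it forces [phi] at the assignment
    [e] of names to variables. The clauses of this relation are those of
    intuitionistic logic, read at all stronger conditions, so that the axioms
    are proved by natural deduction under a varying condition.

    The model enters through one notion, that of a small collection, one
    contained in a set of the model. A class of the Boolean universe is a set as
    soon as its elements are, piecewise, equal to names from a small collection
    ([name_comprehension]). Pairing, Separation, Empty set, Union and Powerset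
    are instances: in each case a small collection is exhibited. For Powerset it
    is the collection of names whose domain lies in that of the given one. For
    Collection, the algebra being a set, one witness per truth value suffices.
    Infinity uses the names of the numerals, and Regularity is induction on
    names.

    For Choice, all names are well-ordered. Picking, for each name [x], one
    element of [x] would not respect equality of names; instead [t] is the value
    of the choice function at [x] to the degree that [t] is the first element of
    [x] ([first_candidate]). This degree respects equality in [x] and is
    disjoint for distinct [t]. By well-foundedness its supremum over [t] is the
    degree to which [x] has an element; at the empty set, any value will do. *)

Set Implicit Arguments.
Unset Strict Implicit.
Unset Printing Implicit Defensive.
Import Order.Theory.
Local Open Scope order_scope.

(** * Sets of the ground model *)

Section Small.
Variable V : ZFC_model.

(** The coding [c] makes one notion cover collections of sets, of names, of
    elements of the algebra and of natural numbers. *)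
Definition small T (c : T -> V) (D : T -> Prop) :=
  exists s, forall t, D t -> inV (c t) s.

Lemma small_sub T (c : T -> V) (D E : T -> Prop) :
  (forall t, D t -> E t) -> small c E -> small c D.
Proof. by move=> DE [s Es]; exists s => t /DE/Es. Qed.

Lemma small_set (D : V -> Prop) :
  small id D -> exists s, forall x, inV x s <-> D x.
Proof.
move=> [s Ds]; have [b bP] := ZFC_separation D s.
by exists b => x; split=> [/bP[]//|Dx]; apply/bP; split=> //; apply: Ds.
Qed.

Lemma small1 T (c : T -> V) (t : T) : small c (fun t' => t' = t).
Proof.
have [p pP] := ZFC_pairing (c t) (c t).
by exists p => _ ->; apply/pP; left.
Qed.

Lemma smallU T (c : T -> V) (D E : T -> Prop) :
  small c D -> small c E -> small c (fun t => D t \/ E t).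
Proof.
move=> [s Ds] [s' Es']; have [p pP] := ZFC_pairing s s'.
have [u uP] := ZFC_union p; exists u => t [Dt|Et]; apply/uP.
  by exists s; [apply/pP; left | exact: Ds].
by exists s'; [apply/pP; right | exact: Es'].
Qed.

(** Replacement collects a family of bounding sets, and Union merges them. *)
Lemma small_bigcup T U (c : T -> V) (c' : U -> V) (D : T -> Prop)
    (E : T -> U -> Prop) : injective c -> small c D ->
  (forall t, D t -> small c' (E t)) ->
  small c' (fun u => exists2 t, D t & E t u).
Proof.
move=> c_inj [s Ds] Esmall.
have /choice[g gP] (t : T) : exists b, D t -> forall u, E t u -> inV (c' u) b.
  have [Dt|nDt] := pselect (D t); first by have [b bP] := Esmall t Dt; exists b.
  by exists s.
pose R x y := exists t, [/\ D t, x = c t & y = g t].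
have [|b bP] := @ZFC_replacement V R s.
  by move=> x y y' _ [t [_ -> ->]] [t' [_ /c_inj-> ->]].
have [u uP] := ZFC_union b; exists u => y [t Dt Ety]; apply/uP; exists (g t).
  by apply/bP; exists (c t); [exact: Ds | exists t].
exact: gP Ety.
Qed.

Lemma small_image T U (c : T -> V) (c' : U -> V) (D : T -> Prop) (f : T -> U) :
  injective c -> small c D -> small c' (fun u => exists2 t, D t & u = f t).
Proof. by move=> ci sD; apply: (small_bigcup ci sD) => t _; apply: small1. Qed.

Lemma opair_exists (a b : V) : exists p, is_opair p a b.
Proof.
have [s sP] := ZFC_pairing a a; have [t tP] := ZFC_pairing a b.
by have [p pP] := ZFC_pairing s t; exists p, s, t.
Qed.

Lemma opair_unique (p q a b : V) : is_opair p a b -> is_opair q a b -> p = q.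
Proof.
move=> [s [t [sP tP pP]]] [s' [t' [sP' tP' qP]]].
have es : s = s' by apply: ZFC_extensionality => z; rewrite sP sP'.
have et : t = t' by apply: ZFC_extensionality => z; rewrite tP tP'.
by apply: ZFC_extensionality => z; rewrite pP qP es et.
Qed.

(** For the second components: each is the common first component or the other
    second component, and applying this both ways leaves only equality. *)
Lemma opair_inj (p a b a' b' : V) :
  is_opair p a b -> is_opair p a' b' -> a = a' /\ b = b'.
Proof.
move=> pab pa'b'.
have fst_le (q x y x' y' : V) : is_opair q x y -> is_opair q x' y' -> x' = x.
  move=> [s [t [sP _ qP]]] [s' [t' [sP' tP' qP']]].
  have x's' : inV x' s' by apply/sP'; left.
  have x't' : inV x' t' by apply/tP'; left.
  suff : inV x' s by move/sP=> [].
  by have /qP'[->|->] : inV s q by apply/qP; left.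
have snd_le (q x y y' : V) : is_opair q x y -> is_opair q x y' ->
  y = x \/ y = y'.
  move=> [s [t [_ tP qP]]] [s' [t' [sP' tP' qP']]].
  have yt : inV y t by apply/tP; right.
  have /qP'[e|e] : inV t q by apply/qP; right.
    by move: yt; rewrite e => /sP'[]; left.
  by move: yt; rewrite e => /tP'.
have ea := fst_le _ _ _ _ _ pab pa'b'; subst a'; split=> //.
have [eb|//] := snd_le _ _ _ _ pab pa'b'.
by have [->|->] := snd_le _ _ _ _ pa'b' pab.
Qed.

(** The von Neumann numerals of the model code the natural numbers; Foundation
    makes the successor map injective. *)
Lemma small_nat : exists c : nat -> V, injective c /\ small c (fun _ => True).
Proof.
have [w [[e ew e0] wS]] := ZFC_infinity V.
have /choice[S SP] (x : V) : exists s, forall z, inV z s <-> inV z x \/ z = x.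
  by apply: small_set; apply: smallU; [exists x | apply: small1].
have S_inj : injective S.
  move=> x y Sxy; have /SP[xy|//] : inV x (S y) by rewrite -Sxy; apply/SP;
    right.
  have /SP[yx|//] : inV y (S x) by rewrite Sxy; apply/SP; right.
  (* Otherwise [x] and [y] are elements of each other. *)
  have [p pP] := ZFC_pairing x y.
  have [|z /pP[->|->] zp] := @ZFC_foundation V p; first by exists x; apply/pP;
    left.
    by case: (zp y yx); apply/pP; right.
  by case: (zp x xy); apply/pP; left.
have S_neq0 x : S x <> e by move=> Sx; apply: (e0 x); rewrite -Sx; apply/SP;
  right.
exists (fun n => iter n S e); split.
  elim=> [|n IH] [|m] //=; first by move/esym/S_neq0.
    by move/S_neq0.
  by move/S_inj/IH->.
exists w => n _; elim: n => //= n /wS[s sw sP].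
suff -> : S (iter n S e) = s by [].
by apply: ZFC_extensionality => z; rewrite SP sP.
Qed.

End Small.

Section Ordinals.
Variable V : ZFC_model.

Lemma ordinal_elem (xi zeta : V) : is_ordinal xi -> inV zeta xi ->
  is_ordinal zeta.
Proof.
move=> [tr el] zxi; split; first exact: el.
by move=> y yz; apply: el; apply: tr yz.
Qed.

Lemma ordinal_succ (xi : V) : is_ordinal xi ->
  exists2 eta, is_ordinal eta & inV xi eta.
Proof.
move=> [tr el].
have [|eta etaP] := @small_set V (fun z => inV z xi \/ z = xi).
  by apply: smallU; [exists xi | exact: small1].
exists eta; last by apply/etaP; right.
split=> [y z /etaP[yxi|->] zy|y /etaP[/el//|->//]]; apply/etaP; left=> //.
exact: tr zy.
Qed.

(** A union of transitive sets of transitive sets is again one. *)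
Lemma ordinal_sup T (c : T -> V) (D : T -> Prop) (g : T -> V) :
    injective c -> small c D -> (forall t, D t -> is_ordinal (g t)) ->
  exists2 eta, is_ordinal eta & forall t, D t -> forall z, inV z (g t) ->
    inV z eta.
Proof.
move=> ci sD gord; have [|eta etaP] := @small_set V (fun z =>
  exists2 t, D t & inV z (g t)).
  by apply: (small_bigcup ci sD) => t _; exists (g t).
exists eta => [|t Dt z zg]; last by apply/etaP; exists t.
split=> [y z /etaP[t Dt yg] zy|y /etaP[t Dt yg]]; last exact: (gord t Dt).2.
by apply/etaP; exists t=> //; apply: (gord t Dt).1 zy.
Qed.

End Ordinals.

(** * Names *)

Section Names.
Variables (V : ZFC_model) (A : Type) (code : A -> V).
Hypothesis code_inj : injective code.
Local Notation name := (name code).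
Implicit Types (u v w x : name) (a b : A).

Definition name_small (D : name -> Prop) := small (fun u : name => sval u) D.

Definition name_dom x u := exists a, name_maps x u a.

Lemma name_val_inj : injective (fun u : name => sval u).
Proof. by move=> [u hu] [v hv] /= e; apply: eq_exist. Qed.

Lemma name_ind (P : name -> Prop) :
  (forall x, (forall u a, name_maps x u a -> P u) -> P x) -> forall x, P x.
Proof.
move=> step [x hx]; have [xi oxi xs] := hx.
elim: xs oxi hx => {}xi {}x zeta zxi _ _ _ IH oxi hx; apply: step => u a.
move=> ua; move: ua (IH (sval u) (code a)); case: u => u hu ua; apply=> //.
exact: ordinal_elem zxi.
Qed.

Lemma name_dom_small x : name_small (name_dom x).
Proof.
(* [u] belongs to a component of a pair in [x], hence to the double union. *)
have [U UP] := ZFC_union (sval x); have [W WP] := ZFC_union U;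
  exists W => u [a [p pu px]].
have [s [t [sP tP pP]]] := pu; apply/WP; exists s; last by apply/sP; left.
by apply/UP; exists p => //; apply/pP; left.
Qed.

(** The graph of [R] is a set by Replacement. Its arguments lie in stages of the
    hierarchy whose indices have a common upper bound [eta], so it belongs to
    the stage of any ordinal above [eta]. *)
Lemma name_exists (R : name -> A -> Prop) :
    (forall u a b, R u a -> R u b -> a = b) ->
    name_small (fun u => exists a, R u a) ->
  exists w, forall u a, name_maps w u a <-> R u a.
Proof.
move=> Rfun Dsmall.
have [|f fP] := @small_set V (fun p => exists2 u, exists a, R u a &
    exists2 a, R u a & is_opair p (sval u) (code a)).
  apply: (small_bigcup name_val_inj Dsmall) => u [a Rua].
  have [q qP] := opair_exists (sval u) (code a).
  apply: small_sub (small1 id q) => p [b Rub pP].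
  by apply: opair_unique qP; rewrite (Rfun _ _ _ Rua Rub).
have mapsf (x y : V) : maps f x y <-> exists u a, [/\ R u a,
  x = sval u & y = code a].
  split=> [[p pxy /fP[u _ [a Rua pua]]]|[u [a [Rua -> ->]]]].
    by exists u, a; have [-> ->] := opair_inj pxy pua.
  have [q qP] := opair_exists (sval u) (code a).
  by exists q=> //; apply/fP; exists u; exists a.
have /choice[g gP] (u : name) : exists xi,
  is_ordinal xi /\ in_stage code xi (sval u).
  by case: u => u [xi oxi us]; exists xi.
have [|eta oeta etaP] := ordinal_sup (g := g) name_val_inj Dsmall.
  by move=> t _; have [] := gP t.
have [theta otheta etatheta] := ordinal_succ oeta.
have wf : is_name code f.
  exists theta=> //; apply: (InStage etatheta).
  - split=> [p /fP[u _ [a _ pua]]|x y z /mapsf[u [a [Rua -> ->]]] /mapsf].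
      by exists (sval u), (code a).
    by move=> [v [b [Rvb /name_val_inj uv ->]]]; rewrite -uv in Rvb;
      rewrite (Rfun _ _ _ Rua Rvb).
  - by move=> x y /mapsf[u [a [_ _ ->]]]; exists a.
  - move=> x y /mapsf[u [a [Rua -> _]]].
    have Du : exists a, R u a by exists a.
    have [_ [zeta zg fu ru du]] := gP u.
    exact: (InStage (etaP u Du zeta zg)).
exists (exist _ f wf) => u a; rewrite /name_maps /=; split=> [/mapsf|Rua].
  by move=> [v [b [Rvb /name_val_inj-> /code_inj->]]].
by apply/mapsf; exists u, a.
Qed.

(** A name with domain inside a small [D] is a subset of the product of [D]
    and [A], of which the model has the powerset. *)
Lemma name_powerset_small (D : name -> Prop) :
    small code (fun _ => True) -> name_small D ->
  name_small (fun x => forall u, name_dom x u -> D u).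
Proof.
move=> As Ds.
have [|s sP] := @small_set V (fun p =>
  exists2 u, D u & exists2 a, True & is_opair p (sval u) (code a)).
  apply: (small_bigcup name_val_inj Ds) => u _;
    apply: (small_bigcup code_inj As) => a _.
  have [q qP] := opair_exists (sval u) (code a).
  by apply: small_sub (small1 id q) => p pP; apply: opair_unique qP.
have [t tP] := ZFC_powerset s; exists t => x xD; apply/tP => p px; apply/sP.
have [xi oxi [zeta zxi [relx fx] rx dx]] := svalP x.
have [u [y puy]] := relx p px.
have [|a ya] := rx u y; first by exists p.
have hu : is_name code u.
  by exists zeta; [exact: ordinal_elem zxi | apply: (dx u y); exists p].
exists (exist _ u hu); last by exists a => //; rewrite -ya.
by apply: xD; exists a; exists p => //; rewrite -ya.
Qed.

End Names.

(** * Well-orders *)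

(** With [lt s t] the negation of [R t s], antisymmetry of [R] becomes
    comparability, and the minimum of a collection has nothing below it there. *)
Lemma well_order_exists (T : Type) : exists lt : T -> T -> Prop,
  (forall s t, s <> t -> lt s t \/ lt t s) /\
  (forall Q : T -> Prop, (exists t, Q t) ->
    exists2 t, Q t & forall s, lt s t -> ~ Q s).
Proof.
have [R Rwo] := well_ordering_principle {classic T}.
exists (fun s t => ~~ R t s); split=> [s t st|Q [t Qt]].
  apply: contrapT => /not_orP[/negP/negPn ts /negP/negPn ts']; apply: st.
  have Rchain : wo_chain R predT by move=> Q _; apply: Rwo.
  by apply: (wo_chain_antisymmetric Rchain); rewrite // ts ts'.
have [|m [[Qm mmin] _]] := Rwo (fun t => `[<Q t>]); first by exists t;
  apply/asboolP.
exists m; first exact/asboolP.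
by move=> s /negP ms Qs; apply: ms; apply: mmin; apply/asboolP.
Qed.

(** * Complete Boolean algebras *)

Section CompleteBoolean.
Variables (d : Order.disp_t) (A : ctbDistrLatticeType d).
Hypothesis Acomplete : complete A.
Implicit Types (g h k a b c : A) (S : set A).

Lemma Sup_supremum S : supremums S (Sup S).
Proof.
have [s sS] := Acomplete S; rewrite /Sup /supremum; case: ifP => [/eqP->|_].
  by split=> [y|y _]; rewrite ?le0x.
by case: xgetP => [//|/(_ s)].
Qed.

Lemma Sup_ub S a : S a -> a <= Sup S.
Proof. exact: (Sup_supremum S).1. Qed.

Lemma Sup_least S c : (forall a, S a -> a <= c) -> Sup S <= c.
Proof. exact: (Sup_supremum S).2. Qed.

Lemma Inf_infimum S : infimums S (Inf S).
Proof.
have [s [ub lub]] := Acomplete (lbound S).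
rewrite /Inf /infimum; case: ifP => [/eqP->|_].
  by split=> [y|y _]; rewrite ?lex1.
case: xgetP => [//|/(_ s)[]]; split=> // y Sy.
by apply: lub => z; exact.
Qed.

Lemma force_Inf h S : h <= Inf S <-> forall a, S a -> h <= a.
Proof.
have [lb glb] := Inf_infimum S; split=> [hS a Sa|]; last exact: glb.
exact: le_trans hS (lb a Sa).
Qed.

Lemma le_bimp h a b : (h <= bimp a b) = (h `&` a <= b).
Proof. by rewrite /bimp -leBLR diffE complK. Qed.

(** Read [h <= a] as: the condition [h] forces [a]. Eliminations pass to a
    stronger condition, which distributivity of the algebra permits. *)
Lemma force_bimp h a b :
  h <= bimp a b <-> forall k, k <= h -> k <= a -> k <= b.
Proof.
rewrite le_bimp; split=> [hab k kh ka|H]; last by apply: H; rewrite ?leIl ?leIr.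
by apply: le_trans hab; rewrite lexI kh.
Qed.

Lemma force_Sup_elim S h c : h <= Sup S ->
  (forall k a, S a -> k <= h -> k <= a -> k <= c) -> h <= c.
Proof.
move=> hS H; have : Sup S <= bimp h c.
  apply: Sup_least => a Sa; rewrite le_bimp; apply: (H _ a) => //.
    exact: leIr.
  exact: leIl.
by move/(le_trans hS)/force_bimp; apply.
Qed.

Lemma force_or_elim h a b c : h <= a `|` b ->
  (forall k, k <= h -> k <= a -> k <= c) ->
  (forall k, k <= h -> k <= b -> k <= c) -> h <= c.
Proof.
move=> hab Ha Hb; suff: a `|` b <= bimp h c by move/(le_trans hab)/force_bimp;
  apply.
rewrite leUx !le_bimp.
by rewrite Ha ?leIl ?leIr // Hb ?leIl ?leIr.
Qed.

Lemma le_eqP a b : (forall h, h <= a <-> h <= b) -> a = b.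
Proof. by move=> H; apply/eqP; rewrite eq_le (H a).1 ?(H b).2. Qed.

(** Excluded middle in the algebra. *)
Lemma force_compl_elim h a c :
  (forall k, k <= h -> k <= a -> k <= c) ->
  (forall k, k <= h -> k <= ~` a -> k <= c) -> h <= c.
Proof. by move=> Ha Hb; apply: (@force_or_elim h a (~` a));
  rewrite // joinxC lex1. Qed.

Lemma force_absurd h a c : h <= a -> h <= ~` a -> h <= c.
Proof. by move=> ha hna; apply: le_trans (le0x c); rewrite -(meetxC a) lexI ha.
Qed.

End CompleteBoolean.

(** What [h] forces, every stronger condition [k] forces: once an elimination
    has passed to [k], all hypotheses follow it there. *)
Ltac restrict kh :=
  match type of kh with
  | is_true (?k <= ?h) =>
    repeat match goal with
    | H : is_true (h <= _) |- _ => apply (le_trans kh) in H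
    end;
    clear kh; try clear h
  end.

(** * Closing formulas *)

Section Closing.
Variable C : Type.
Implicit Types (phi p : formula C) (s : nat -> option C) (e : nat -> C).

Definition upd T (s : nat -> T) x c := fun y => if y == x then c else s y.

Lemma updE T (s : nat -> T) x c : upd s x c x = c.
Proof. by rewrite /upd eqxx. Qed.

(** Closing works with partial assignments: a quantifier makes its variable
    undefined again, so that an instance of a closed quantified formula is the
    closure of its body at an updated assignment ([subst_close]). *)
Definition tclose s (t : term C) : term C :=
  if t is Var x then if s x is Some c then Cst c else t else t.

Fixpoint close s phi : formula C :=
  match phi with
  | Bot => Bot
  | Elem t r => Elem (tclose s t) (tclose s r)
  | Eqv t r => Eqv (tclose s t) (tclose s r)
  | And p q => And (close s p) (close s q)
  | Or p q => Or (close s p) (close s q)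
  | Imp p q => Imp (close s p) (close s q)
  | Neg p => Neg (close s p)
  | All y p => All y (close (upd s y None) p)
  | Ex y p => Ex y (close (upd s y None) p)
  end.

Lemma tclose_ext s s' (t : term C) : (forall x, tfree x t -> s x = s' x) ->
  tclose s t = tclose s' t.
Proof. by case: t => //= y ->. Qed.

Lemma close_ext phi s s' : (forall x, free x phi -> s x = s' x) ->
  close s phi = close s' phi.
Proof.
elim: phi s s' => //=
  [t r|t r|p IHp q IHq|p IHp q IHq|p IHp q IHq|p IHp|y p IHp|y p IHp] s s' H.
1,2: by f_equal; apply: tclose_ext => x xf; apply: H; rewrite xf ?orbT.
1-3: by f_equal; [apply: IHp|apply: IHq] => x xf; apply: H; rewrite xf ?orbT.
  by rewrite (IHp s s').
1,2: f_equal; apply: IHp => x xf; rewrite /upd; case: (eqVneq x y) => // xy.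
1,2: by apply: H; rewrite xy.
Qed.

Lemma tfree_tclose s (t : term C) x :
  tfree x (tclose s t) = tfree x t && ~~ isSome (s x).
Proof.
case: t => //= y; case E: (s y) => [c|] /=.
  by case: eqP => // ->; rewrite E.
by case: eqP => // ->; rewrite E.
Qed.

Lemma free_close phi s x : free x (close s phi) = free x phi && ~~ isSome (s x).
Proof.
elim: phi s => //=
  [t r|t r|p IHp q IHq|p IHp q IHq|p IHp q IHq|y p IHp|y p IHp] s.
1,2: by rewrite !tfree_tclose andb_orl.
1-3: by rewrite IHp IHq andb_orl.
1,2: by rewrite IHp /upd; case: eqP.
Qed.

Lemma tsubst_tclose s (t : term C) x c : s x = None ->
  tsubst x (Cst c) (tclose s t) = tclose (upd s x (Some c)) t.
Proof.
rewrite /tsubst tfree_tclose => ->; rewrite andbT.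
by case: t => //= y; rewrite /upd eq_sym; case: eqP.
Qed.

Lemma subst_close phi s x c : s x = None ->
  subst x (Cst c) (close s phi) = close (upd s x (Some c)) phi.
Proof.
elim: phi s => //=
  [t r|t r|p IHp q IHq|p IHp q IHq|p IHp q IHq|p IHp|y p IHp|y p IHp] s sx.
1,2: by rewrite !tsubst_tclose.
1-3: by rewrite IHp ?IHq.
  by rewrite IHp.
1,2: f_equal; case: (eqVneq x y) => [->|xy].
1,3: by apply: close_ext => z _; rewrite /upd; case: eqP.
1,2: rewrite IHp ?/upd ?(negPf xy) //; apply: close_ext => z _; rewrite /upd.
1,2: by case: (eqVneq z x) => // ->; rewrite (negPf xy).
Qed.

Lemma subst_nonfree (x : nat) (r : term C) p : ~~ free x p -> subst x r p = p.
Proof.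
have tE (t : term C) : ~~ tfree x t -> tsubst x r t = t.
  by rewrite /tsubst; case: ifP.
elim: p => //=
  [t t'|t t'|p IHp q IHq|p IHp q IHq|p IHp q IHq|p IHp|y p IHp|y p IHp].
1,2: by rewrite negb_or => /andP[/tE-> /tE->].
1-3: by rewrite negb_or => /andP[/IHp-> /IHq->].
  by move/IHp->.
1,2: by case: eqP => //= _ /IHp->.
Qed.

Lemma close_subst_var s x y c p : s y = Some c -> free_for y x p ->
  close s (subst x (Var y) p) = close (upd s x (Some c)) p.
Proof.
have tE s' (t : term C) : s' y = Some c ->
    tclose s' (tsubst x (Var y) t) = tclose (upd s' x (Some c)) t.
  move=> s'y; case: t => //= n; rewrite /tsubst /= /upd eq_sym.
  by case: eqP => //=; rewrite s'y.
have quant s' n q : s' y = Some c ->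
    ~~ free x (All n q) || (y != n) && free_for y x q ->
    (forall s, s y = Some c -> free_for y x q ->
      close s (subst x (Var y) q) = close (upd s x (Some c)) q) ->
    close (upd s' n None) (if x == n then q else subst x (Var y) q)
    = close (upd (upd s' x (Some c)) n None) q.
  move=> s'y ff IH; have [<-|xn] := eqVneq x n.
    by apply: close_ext => m _; rewrite /upd; case: eqP.
  have [xq|xq] := boolP (free x q).
    move: ff; rewrite /= xn xq /= => /andP[/negPf yn ff].
    rewrite IH /upd ?yn //; apply: close_ext => m _.
    by case: (eqVneq m x) => // ->; rewrite (negPf xn).
  rewrite subst_nonfree //; apply: close_ext => m mq; rewrite /upd.
  by case: eqP => //; case: eqP => // mx; rewrite -mx mq in xq.
elim: p s => //=
  [t r|t r|p IHp q IHq|p IHp q IHq|p IHp q IHq|p IHp|n p IHp|n p IHp] s sy.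
1,2: by rewrite !tE.
1-3: by move=> /andP[fp fq]; rewrite IHp ?IHq.
  by move=> fp; rewrite IHp.
1,2: by move=> ff; f_equal; apply: quant.
Qed.

Definition teval e (t : term C) := match t with Var x => e x | Cst c => c end.

Lemma close_sentence phi e : sentence (close (Some \o e) phi).
Proof. by move=> x; rewrite free_close andbF. Qed.

End Closing.

(** * The forcing relation *)

Section Forcing.
Variables (V : ZFC_model) (d : Order.disp_t) (A : ctbDistrLatticeType d).
Hypothesis Acomplete : complete A.
Variables (code : A -> V) (N : A -> set A) (I : formula (name code) -> A).
Hypothesis code_inj : injective code.
Hypothesis I_int : interpretation N I.
Local Notation name := (name code).
Local Notation cst := (@Cst name).
Implicit Types (u v w x y z t : name) (a b c g h k : A) (p q phi : formula name)
  (e : nat -> name) (D : name -> Prop).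

Definition isin u v := I (Elem (cst u) (cst v)).
Definition eqv u v := I (Eqv (cst u) (cst v)).

(** An interpretation is only constrained on sentences, so a formula is closed
    by the assignment before it is interpreted. *)
Definition ev e phi := I (close (Some \o e) phi).

Lemma tclose_total e (t : term name) : tclose (Some \o e) t = cst (teval e t).
Proof. by case: t. Qed.

Lemma ev_ext e e' phi : (forall n : nat, free n phi -> e n = e' n) ->
  ev e phi = ev e' phi.
Proof. by move=> H; congr I; apply: close_ext => x /H /= ->. Qed.

Lemma ev_subst_var e (x y : nat) p : free_for y x p ->
  ev e (subst x (Var y) p) = ev (upd e x (e y)) p.
Proof.
move=> fp; rewrite /ev (@close_subst_var _ _ _ _ (e y)) //.
by congr I; apply: close_ext => n _; rewrite /upd /=; case: eqP.
Qed.

Lemma ev_sentence e phi : sentence phi -> I phi = ev e phi.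
Proof.
move=> sphi; congr I; have close_none : forall p, close (fun _ => None) p = p.
  elim=> //=
    [[n|c] [m|c']|[n|c] [m|c']|?->?->|?->?->|?->?->|?->|n p IHp|n p IHp] //.
    by congr All; rewrite -[RHS]IHp; apply: close_ext => m _; rewrite /upd;
      case: eqP.
  by congr Ex; rewrite -[RHS]IHp; apply: close_ext => m _; rewrite /upd;
    case: eqP.
rewrite -[LHS]close_none; apply: close_ext => n nf.
by have := sphi n; rewrite nf.
Qed.

(** ** Clauses for the atoms *)

Lemma force_mem_intro h u v x a :
  name_maps v x a -> h <= a -> h <= eqv x u -> h <= isin u v.
Proof.
move=> vx ha hx; rewrite /isin (int_mem I_int).
apply: le_trans (Sup_ub Acomplete _); last first.
  by exists x, a; split; first exact: vx.
by rewrite lexI ha.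
Qed.

Lemma force_mem_elim h u v c : h <= isin u v ->
  (forall x a k, name_maps v x a -> k <= h -> k <= a -> k <= eqv x u ->
    k <= c) ->
  h <= c.
Proof.
rewrite /isin (int_mem I_int) => hS H; apply: (force_Sup_elim Acomplete hS).
move=> k b [x [a [vx ->]]] kh; rewrite lexI => /andP[ka kx].
exact: H vx kh ka kx.
Qed.

Lemma force_eqv h u v : h <= eqv u v <->
  (forall x a k, name_maps u x a -> k <= h -> k <= a -> k <= isin x v) /\
  (forall x a k, name_maps v x a -> k <= h -> k <= a -> k <= isin x u).
Proof.
rewrite /eqv (int_eqv I_int) lexI;
  split=> [/andP[/(force_Inf Acomplete) H1 /(force_Inf Acomplete) H2]|[H1 H2]].
  by split=> x a k ux kh ka; apply: ((force_bimp h a _).1 _ k kh ka);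
    [apply: H1 | apply: H2]; exists x, a.
apply/andP; split; apply/(force_Inf Acomplete) => _ [x [a [ux ->]]];
  apply/force_bimp => k kh ka.
  exact: H1 ux kh ka.
exact: H2 ux kh ka.
Qed.

Lemma force_eqv_refl h u : h <= eqv u u.
Proof.
elim/(@name_ind V A code): u h => u IH h; apply/force_eqv.
by split=> x a k ux _ ka; apply: force_mem_intro ux ka (IH _ _ ux _).
Qed.

Lemma force_mem_dom h v x a : name_maps v x a -> h <= a -> h <= isin x v.
Proof. by move=> vx ha; apply: force_mem_intro vx ha (force_eqv_refl _ _). Qed.

Lemma eqvC u v : eqv u v = eqv v u.
Proof. by rewrite /eqv !(int_eqv I_int) meetC. Qed.

Lemma force_eqv_sym h u v : h <= eqv u v -> h <= eqv v u.
Proof. by rewrite eqvC. Qed.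

(** Induction on [u]: the elements of [u] are compared, through [v], with those
    of [w]. *)
Lemma force_eqv_trans h u v w : h <= eqv u v -> h <= eqv v w -> h <= eqv u w.
Proof.
elim/(@name_ind V A code): u h v w =>
  u IH h v w /force_eqv[uv vu] /force_eqv[vw wv].
apply/force_eqv; split=> x a k.
  move=> ux kh ka; apply: (force_mem_elim (uv _ _ _ ux kh ka)).
  move=> y b l vy lk lb yx.
  apply: (force_mem_elim (vw _ _ _ vy (le_trans lk kh) lb)).
  move=> z c m wz ml mc zy.
  apply: (force_mem_intro wz mc); apply: force_eqv_sym.
  apply: (IH _ _ ux _ y); apply: force_eqv_sym => //; exact: le_trans yx.
move=> wx kh ka; apply: (force_mem_elim (wv _ _ _ wx kh ka)).
move=> y b l vy lk lb yx.
apply: (force_mem_elim (vu _ _ _ vy (le_trans lk kh) lb)).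
move=> z c m uz ml mc zy; apply: (force_mem_intro uz mc).
by apply: (IH _ _ uz _ y) => //; apply: le_trans yx.
Qed.

Lemma force_mem_eqvl h u u' v : h <= eqv u u' -> h <= isin u v ->
  h <= isin u' v.
Proof.
move=> uu' uv; apply: (force_mem_elim uv) => x a k vx kh ka xu; restrict kh.
by apply: (force_mem_intro vx ka); apply: force_eqv_trans xu uu'.
Qed.

Lemma force_mem_eqvr h u v v' : h <= eqv v v' -> h <= isin u v ->
  h <= isin u v'.
Proof.
move=> /force_eqv[vv' _] uv; apply: (force_mem_elim uv) => x a k vx kh ka xu.
by apply: force_mem_eqvl xu _; apply: vv' vx kh ka.
Qed.

Lemma force_ext h u v :
  h <= eqv u v <-> forall k z, k <= h -> (k <= isin z u <-> k <= isin z v).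
Proof.
split=> [uv k z kh|H].
  by restrict kh; split; apply: force_mem_eqvr => //; apply: force_eqv_sym.
apply/force_eqv; split=> x a k ux kh ka; apply/(H k x kh);
  exact: force_mem_dom ka.
Qed.

(** ** Clauses for the connectives and quantifiers *)

Lemma ev_elem e (t r : term name) :
  ev e (Elem t r) = isin (teval e t) (teval e r).
Proof. by rewrite /ev /= !tclose_total. Qed.

Lemma ev_eqv e (t r : term name) : ev e (Eqv t r) = eqv (teval e t) (teval e r).
Proof. by rewrite /ev /= !tclose_total. Qed.

Lemma ev_bot e : ev e Bot = \bot.
Proof. exact: int_bot I_int. Qed.

Lemma ev_and e p q : ev e (And p q) = ev e p `&` ev e q.
Proof. by rewrite /ev /= (int_and I_int) //; apply: close_sentence. Qed.

Lemma ev_or e p q : ev e (Or p q) = ev e p `|` ev e q.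
Proof. by rewrite /ev /= (int_or I_int) //; apply: close_sentence. Qed.

Lemma ev_imp e p q : ev e (Imp p q) = bimp (ev e p) (ev e q).
Proof. by rewrite /ev /= (int_imp I_int) //; apply: close_sentence. Qed.

Lemma ev_upd e (n : nat) u p :
  I (subst n (cst u) (close (upd (Some \o e) n None) p)) = ev (upd e n u) p.
Proof.
rewrite subst_close ?updE //; congr I; apply: close_ext => m _.
by rewrite /upd /=; case: eqP.
Qed.

Lemma sentence_all e (n : nat) p :
  sentence (All n (close (upd (Some \o e) n None) p)).
Proof.
by move=> m /=; rewrite free_close /upd; case: eqP => //= _; rewrite andbF.
Qed.

Lemma force_all h e (n : nat) p :
  h <= ev e (All n p) <-> forall u, h <= ev (upd e n u) p.
Proof.
rewrite /ev /= (int_all I_int (@sentence_all e n p)).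
split=> [/(force_Inf Acomplete) H u|H].
  by rewrite -/(ev _ _) -ev_upd; apply: H; exists u.
by apply/(force_Inf Acomplete) => _ [u _ <-]; rewrite ev_upd; apply: H.
Qed.

Lemma ev_ex e (n : nat) p :
  ev e (Ex n p) = Sup (range (fun u => ev (upd e n u) p)).
Proof.
rewrite /ev /= (int_ex I_int (@sentence_all e n p)).
by congr Sup; congr image; apply/funext => u; rewrite ev_upd.
Qed.

Lemma force_ex_intro h e (n : nat) p u :
  h <= ev (upd e n u) p -> h <= ev e (Ex n p).
Proof.
rewrite ev_ex => H; apply: le_trans H (Sup_ub Acomplete _); by exists u.
Qed.

Lemma force_ex_elim h e (n : nat) p c : h <= ev e (Ex n p) ->
  (forall u k, k <= h -> k <= ev (upd e n u) p -> k <= c) -> h <= c.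
Proof.
rewrite ev_ex => hS H; apply: (force_Sup_elim Acomplete hS) => k _ [u _ <-].
exact: H.
Qed.

Lemma force_and h e p q : h <= ev e (And p q) <-> h <= ev e p /\ h <= ev e q.
Proof. by rewrite ev_and lexI; split=> /andP. Qed.

Lemma force_imp h e p q :
  h <= ev e (Imp p q) <-> forall k, k <= h -> k <= ev e p -> k <= ev e q.
Proof. by rewrite ev_imp; apply: force_bimp. Qed.

Lemma force_iff h e p q : h <= ev e (Iff p q) <->
  forall k, k <= h -> (k <= ev e p <-> k <= ev e q).
Proof.
split=> [/force_and[/force_imp pq /force_imp qp] k kh|H].
  by split; [apply: pq | apply: qp].
by apply/force_and; split; apply/force_imp => k kh; apply H.
Qed.

Lemma teval_upd e (n : nat) u (t : term name) : ~~ tfree n t ->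
  teval (upd e n u) t = teval e t.
Proof. by case: t => //= m; rewrite /upd eq_sym; case: eqP. Qed.

Lemma force_allin h e (n : nat) (t : term name) p : ~~ tfree n t ->
  h <= ev e (AllIn n t p) <->
  forall u k, k <= h -> k <= isin u (teval e t) -> k <= ev (upd e n u) p.
Proof.
move=> nt; split=> [/force_all H u k kh ku|H].
  by have /force_imp := H u; apply => //; rewrite ev_elem /= updE teval_upd.
apply/force_all => u; apply/force_imp => k kh.
by rewrite ev_elem /= updE teval_upd // => ku; apply: H.
Qed.

Lemma force_exin_intro h e (n : nat) (t : term name) p u : ~~ tfree n t ->
  h <= isin u (teval e t) -> h <= ev (upd e n u) p -> h <= ev e (ExIn n t p).
Proof.
move=> nt hu hp; apply: (force_ex_intro (u := u)); apply/force_and; split=> //.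
by rewrite ev_elem /= updE teval_upd.
Qed.

(** The Leibniz law holds by stipulation for negations, and by induction for
    all other formulas. *)
Lemma force_leibniz h u v e (n : nat) p :
  h <= eqv u v -> h <= ev (upd e n u) p -> h <= ev (upd e n v) p.
Proof.
have tevalP k x y e' (t : term name) : k <= eqv x y ->
    k <= eqv (teval (upd e' n x) t) (teval (upd e' n y) t).
  case: t => [m|c] /= xy; last exact: force_eqv_refl.
  by rewrite /upd; case: eqP => // _; apply: force_eqv_refl.
have swap e' (m : nat) x y q : m != n ->
    ev (upd (upd e' n x) m y) q = ev (upd (upd e' m y) n x) q.
  move=> mn; apply: ev_ext => l _; rewrite /upd.
  by case: (eqVneq l m) => // ->; rewrite (negPf mn).
have same e' x y q : ev (upd (upd e' n x) n y) q = ev (upd e' n y) q.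
  by apply: ev_ext => l _; rewrite /upd; case: eqP.
elim: p h u v e =>
  [|t r|t r|p IHp q IHq|p IHp q IHq|p IHp q IHq|p _|m p IHp|m p IHp] h u v e uv.
- by rewrite !ev_bot.
- rewrite !ev_elem => H; apply: force_mem_eqvl (tevalP _ _ _ _ _ uv) _.
  by apply: force_mem_eqvr (tevalP _ _ _ _ _ uv) _.
- rewrite !ev_eqv => H; apply: force_eqv_trans (tevalP _ _ _ _ _ uv).
  by apply: force_eqv_trans H; apply: force_eqv_sym; apply: tevalP.
- by move=> /force_and[hp hq]; apply/force_and; split;
  [apply: IHp uv hp | apply: IHq uv hq].
- rewrite !ev_or => H; apply: (force_or_elim H) => k kh kp; restrict kh.
    by apply: lexUl; apply: IHp uv kp.
  by apply: lexUr; apply: IHq uv kp.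
- move=> /force_imp H; apply/force_imp => k kh kp.
  have kuv := le_trans kh uv; apply: (IHq _ _ _ _ kuv); apply: (H k kh).
  exact: IHp (force_eqv_sym kuv) kp.
- pose q := close (upd (Some \o e) n None) p.
  have evN w : ev (upd e n w) (Neg p) = I (Neg (subst n (cst w) q)).
    by rewrite -ev_upd.
  have Lq := @int_leibniz _ _ _ _ _ _ I_int u v n q (@sentence_all e n p).
  rewrite !evN => hu.
  exact: ((force_bimp _ _ _).1 (le_trans uv Lq) h (lexx h) hu).
- move=> /force_all H; apply/force_all => w; move: (H w).
  case: (eqVneq m n) => [->|mn]; first by rewrite !same.
  by rewrite !swap //; apply: IHp.
- move=> H; apply: (force_ex_elim H) => w k kh kp.
  apply: (force_ex_intro (u := w)); move: kp.
  case: (eqVneq m n) => [->|mn]; first by rewrite !same.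
  by rewrite !swap //; apply: IHp; apply: le_trans uv.
Qed.

(** ** Existence of names *)

Definition extensional_map (F : name -> A) :=
  forall h u v, h <= eqv u v -> h <= F u -> h <= F v.

Lemma ev_extensional e (n : nat) p :
  extensional_map (fun u => ev (upd e n u) p).
Proof. by move=> h u v; apply: force_leibniz. Qed.

(** A class of the Boolean universe all of whose elements are equal, piecewise,
    to names from a small collection is a set: the name sends each [t] in the
    collection to the truth value of its membership. *)
Lemma name_comprehension D (F : name -> A) :
    name_small D -> extensional_map F ->
    (forall z, F z <= Sup (fun b => exists2 t, D t & b = eqv t z)) ->
  exists w, forall z, isin z w = F z.
Proof.
move=> Dsmall Fext FD.
have [||w wP] := @name_exists _ _ code code_inj (fun t a => D t /\ a = F t).
- by move=> u a b [_ ->] [_ ->].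
- by apply: small_sub Dsmall => t [a []].
exists w => z; apply: le_eqP => h; split=> [hz|hz].
  apply: (force_mem_elim hz) => x a k /wP[_ ->] _ kF kx; exact: Fext kx kF.
apply: (force_Sup_elim Acomplete (le_trans hz (FD z))) => k _ [t Dt ->] kh kt.
apply: (@force_mem_intro _ _ _ t (F t)) => //; first exact/wP.
by apply: Fext (force_eqv_sym kt) _; apply: le_trans hz.
Qed.

Lemma name_of_values (R : name -> A -> Prop) :
    name_small (fun t => exists a, R t a) ->
  exists w, forall z, isin z w = Sup (fun b =>
    exists t a, R t a /\ b = a `&` eqv t z).
Proof.
move=> Rsmall; apply: (name_comprehension Rsmall).
  move=> h u v uv hu; apply: (force_Sup_elim Acomplete hu) =>
    k _ [t [a [Rta ->]]] kh.
  rewrite lexI => /andP[ka kt]; restrict kh.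
  apply: le_trans (Sup_ub Acomplete _); last by exists t, a; split;
    first exact: Rta.
  by rewrite lexI ka; apply: force_eqv_trans uv.
move=> z; apply: Sup_least => // _ [t [a [Rta ->]]].
by apply: le_trans (leIr _ _) (Sup_ub Acomplete _); exists t => //; exists a.
Qed.

Lemma name_of_set D : name_small D ->
  exists w, forall z, isin z w = Sup (fun b => exists2 t, D t & b = eqv t z).
Proof.
move=> Ds; apply: (name_comprehension Ds) => // h u v uv hu.
apply: (force_Sup_elim Acomplete hu) => k _ [t Dt ->] kh kt; restrict kh.
apply: le_trans (Sup_ub Acomplete _); last by exists t; first exact: Dt.
exact: force_eqv_trans uv.
Qed.

(** The common form of Pairing, Powerset, Separation, Empty set and Union, which
    differ by the collection [D] that bounds the class defined by [p]. *)
Lemma force_comprehension e (w z : nat) p D : w != z -> ~~ free w p ->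
    name_small D ->
    (forall u, ev (upd e z u) p <= Sup (fun b =>
      exists2 t, D t & b = eqv t u)) ->
  forall h, h <= ev e (Ex w (All z (Iff (Elem (Var z) (Var w)) p))).
Proof.
move=> wz wp Ds pD h.
have [x xP] := name_comprehension Ds (@ev_extensional e z p) pD.
apply: (force_ex_intro (u := x)); apply/force_all => u; apply/force_iff => k _.
rewrite ev_elem /= updE {1}/upd (negPf wz) updE xP.
suff -> : ev (upd (upd e w x) z u) p = ev (upd e z u) p by [].
apply: ev_ext => n np; rewrite /upd; case: eqP => // _; case: eqP => // nw.
by rewrite -nw np in wp.
Qed.

(** ** Empty set, successors and pairs *)

Lemma empty_exists : exists w, forall z, isin z w = \bot.
Proof.
have [s _] := ZFC_infinity V.
by apply: (@name_comprehension (fun _ => False)) => //; exists s.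
Qed.

Definition empty_name := sval (cid empty_exists).

Lemma mem_empty z : isin z empty_name = \bot.
Proof. by rewrite /empty_name; case: cid. Qed.

Lemma succ_exists y : exists w, forall z, isin z w = isin z y `|` eqv z y.
Proof.
apply: (name_comprehension (D := fun t => name_dom y t \/ t = y)).
- exact: smallU (name_dom_small y) (small1 _ y).
- move=> h u v uv hu; apply: (force_or_elim hu) => k kh ku; restrict kh.
    by apply: lexUl; apply: force_mem_eqvl uv ku.
  by apply: lexUr; apply: force_eqv_trans (force_eqv_sym uv) ku.
- move=> z; apply: (force_or_elim (lexx _)) => k _ kz.
    apply: (force_mem_elim kz) => x a l yx _ _ xz;
      apply: le_trans xz (Sup_ub Acomplete _).
    by exists x => //; left; exists a.
  by apply: le_trans kz (Sup_ub Acomplete _); exists y; [right | apply: eqvC].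
Qed.

Definition succ_name y := sval (cid (succ_exists y)).

Lemma mem_succ z y : isin z (succ_name y) = isin z y `|` eqv z y.
Proof. by rewrite /succ_name; case: cid. Qed.

Lemma upair_exists x y : exists w, forall z, isin z w = eqv z x `|` eqv z y.
Proof.
have [|w wP] := @name_of_set (fun t => t = x \/ t = y).
  exact: smallU (small1 _ x) (small1 _ y).
exists w => z; rewrite wP; apply: le_anti; rewrite leUx; apply/and3P; split.
- by apply: Sup_least => // _ [t [->|->] ->]; rewrite eqvC ?leUl ?leUr.
- by apply: Sup_ub => //; exists x; [left | rewrite eqvC].
- by apply: Sup_ub => //; exists y; [right | rewrite eqvC].
Qed.

Definition upair x y := sval (cid (upair_exists x y)).
Definition opair x y := upair (upair x x) (upair x y).

Lemma mem_upair z x y : isin z (upair x y) = eqv z x `|` eqv z y.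
Proof. by rewrite /upair; case: cid. Qed.

Lemma force_upair_cong h x x' y y' :
  h <= eqv x x' -> h <= eqv y y' -> h <= eqv (upair x y) (upair x' y').
Proof.
have sub k u u' v v' z : k <= eqv u u' -> k <= eqv v v' ->
    k <= isin z (upair u v) -> k <= isin z (upair u' v').
  move=> uu' vv'; rewrite !mem_upair => kz.
  apply: (force_or_elim kz) => l lk lz; restrict lk.
    by apply: lexUl; apply: force_eqv_trans uu'.
  by apply: lexUr; apply: force_eqv_trans vv'.
move=> xx' yy'; apply/force_ext => k z kh; restrict kh.
by split; apply: sub => //; apply: force_eqv_sym.
Qed.

Lemma force_opair_cong h x x' y y' :
  h <= eqv x x' -> h <= eqv y y' -> h <= eqv (opair x y) (opair x' y').
Proof. by move=> xx' yy'; do 2?apply: force_upair_cong. Qed.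

(** As for the pairs of the model, the second components are compared both ways
    with each other and with the first one. *)
Lemma force_opair_inj h x y x' y' :
  h <= eqv (opair x y) (opair x' y') -> h <= eqv x x' /\ h <= eqv y y'.
Proof.
have fst_le k u v u' v' : k <= eqv (opair u v) (opair u' v') -> k <= eqv u' u.
  move=> E; have : k <= isin (upair u u) (opair u' v').
    by apply: force_mem_eqvr E _; rewrite mem_upair lexUl ?force_eqv_refl.
  rewrite mem_upair => H; apply: (force_or_elim H) => l lk lE; restrict lk;
    rewrite -[eqv u' u]joinxx -mem_upair;
    apply: force_mem_eqvr (force_eqv_sym lE) _;
    by rewrite mem_upair lexUl ?force_eqv_refl.
have snd_le k u v v' : k <= eqv (opair u v) (opair u v') ->
  k <= eqv v u `|` eqv v v'.
  move=> E; have : k <= isin (upair u v) (opair u v').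
    by apply: force_mem_eqvr E _; rewrite mem_upair lexUr ?force_eqv_refl.
  rewrite mem_upair => H; apply: (force_or_elim H) => l lk lE; restrict lk.
    have : l <= isin v (upair u u).
      by apply: force_mem_eqvr lE _; rewrite mem_upair lexUr ?force_eqv_refl.
    by rewrite mem_upair joinxx => lv; apply: lexUl.
  rewrite -mem_upair.
  by apply: force_mem_eqvr lE _; rewrite mem_upair lexUr ?force_eqv_refl.
move=> E; have xx' := force_eqv_sym (fst_le _ _ _ _ _ E); split=> //.
have E' : h <= eqv (opair x y) (opair x y').
  by apply: force_eqv_trans E _;
    apply: force_opair_cong (force_eqv_sym xx') (force_eqv_refl _ _).
have H := snd_le _ _ _ _ E'; have H' := snd_le _ _ _ _ (force_eqv_sym E').
apply: (force_or_elim H) => // k kh kyx; restrict kh.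
apply: (force_or_elim H') => // l lk ky'; restrict lk;
  last exact: force_eqv_sym.
by apply: force_eqv_trans kyx _; apply: force_eqv_sym.
Qed.

(** ** Definable notions *)

(** By extensionality, a formula that says what the elements of [t] are says
    that [t] equals any name with these membership values. All defined notions
    of the language are evaluated in this way. *)
Lemma ev_definition e (n : nat) (t : term name) p w : ~~ tfree n t ->
    (forall z, ev (upd e n z) p = isin z w) ->
  ev e (All n (Iff (Elem (Var n) t) p)) = eqv (teval e t) w.
Proof.
move=> nt pw; apply: le_eqP => h; rewrite force_ext force_all.
have E z : ev (upd e n z) (Elem (Var n) t) = isin z (teval e t).
  by rewrite ev_elem /= updE teval_upd.
split=> [H k z kh|H z]; last by apply/force_iff => k kh; rewrite E pw; apply: H.
by have /force_iff/(_ k kh) := H z; rewrite E pw.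
Qed.

Lemma eqv_refl u : eqv u u = \top.
Proof. by apply/eqP; rewrite -le1x force_eqv_refl. Qed.

Lemma ev_absurd e (t : term name) : ev e (Imp (Eqv t t) Bot) = \bot.
Proof. by rewrite ev_imp ev_eqv ev_bot eqv_refl /bimp compl1 joinxx. Qed.

Lemma ev_EmptyF e (x : nat) : x != 20 ->
  ev e (@EmptyF name x) = eqv (e x) empty_name.
Proof.
by move=> x20; apply: ev_definition => [|z] /=;
  [rewrite eq_sym | rewrite ev_absurd mem_empty].
Qed.

Lemma ev_SuccF e (x y : nat) : x != 20 -> y != 20 ->
  ev e (@SuccF name x y) = eqv (e x) (succ_name (e y)).
Proof.
move=> x20 /negPf y20; apply: ev_definition => [|z] /=; first by rewrite eq_sym.
by rewrite ev_or ev_elem ev_eqv mem_succ /= updE /upd y20.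
Qed.

Lemma ev_PairF e (p : term name) (x y : nat) : ~~ tfree 20 p -> x != 20 ->
  y != 20 ->
  ev e (@PairF name p x y) = eqv (teval e p) (upair (e x) (e y)).
Proof.
move=> p20 /negPf x20 /negPf y20; apply: ev_definition => // z.
by rewrite ev_or !ev_eqv mem_upair /= updE /upd x20 y20.
Qed.

Lemma ev_OPairF e (p : term name) (x y : nat) :
    [&& ~~ tfree 20 p, ~~ tfree 21 p & ~~ tfree 22 p] ->
    x \notin [:: 20; 21; 22] -> y \notin [:: 20; 21; 22] ->
  ev e (@OPairF name p x y) = eqv (teval e p) (opair (e x) (e y)).
Proof.
rewrite !inE !negb_or => /and3P[p0 p1 p2] /and3P[x0 x1 x2] /and3P[y0 y1 y2].
have E (a b : name) : ev (upd (upd e 21 a) 22 b)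
    (And (@PairF name (Var 21) x x)
       (And (@PairF name (Var 22) x y) (@PairF name p 21 22)))
  = eqv a (upair (e x) (e x)) `&`
    (eqv b (upair (e x) (e y)) `&` eqv (teval e p) (upair a b)).
  rewrite !ev_and !ev_PairF // (teval_upd _ _ p2) (teval_upd _ _ p1) /upd /=.
  by rewrite (negPf x1) (negPf x2) (negPf y1) (negPf y2).
apply: le_eqP => h; split=> [H|H].
  apply: (force_ex_elim H) => a k kh H1; apply: (force_ex_elim H1) => b l lk.
  rewrite E !lexI => /and3P[la lb lp].
  by apply: force_eqv_trans lp _; apply: force_upair_cong.
apply: (force_ex_intro (u := upair (e x) (e x))).
apply: (force_ex_intro (u := upair (e x) (e y))).
by rewrite E !lexI !force_eqv_refl.
Qed.

Lemma ev_AppF e (f : term name) (x y : nat) : ~~ tfree 23 f ->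
    x \notin [:: 20; 21; 22; 23] -> y \notin [:: 20; 21; 22; 23] ->
  ev e (@AppF name f x y) = isin (opair (e x) (e y)) (teval e f).
Proof.
rewrite !inE !negb_or => f3 /and4P[x0 x1 x2 x3] /and4P[y0 y1 y2 y3].
have E (a : name) :
    ev (upd e 23 a) (And (Elem (Var 23) f) (@OPairF name (Var 23) x y))
  = isin a (teval e f) `&` eqv a (opair (e x) (e y)).
  rewrite ev_and ev_elem ev_OPairF ?inE ?negb_or;
    [|by []|by apply/and3P|by apply/and3P].
  by rewrite (teval_upd _ _ f3) /= /upd (negPf x3) (negPf y3).
apply: le_eqP => h; split=> [H|H].
  apply: (force_ex_elim H) => a k kh; rewrite E lexI => /andP[kf ka].
  exact: force_mem_eqvl ka kf.
by apply: (force_ex_intro (u := opair (e x) (e y)));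
  rewrite E lexI H force_eqv_refl.
Qed.

(** * The axioms of set theory *)

Hypothesis Asmall : small code (fun _ => True).

Lemma force_foralls h e (ns : seq nat) p :
  (forall e', h <= ev e' p) -> h <= ev e (Foralls ns p).
Proof.
by move=> H; elim: ns e => //= n ns IH e; apply/force_all => u; apply: IH.
Qed.

Lemma force_extensionality h e : h <= ev e (Extensionality name).
Proof.
apply/force_all => u; apply/force_all => v; apply/force_imp => k _.
by rewrite (@ev_definition _ _ _ _ v) // => z; rewrite ev_elem.
Qed.

Lemma force_pairing h e : h <= ev e (Pairing name).
Proof.
apply/force_all => u; apply/force_all => v.
apply: (@force_comprehension _ 2 3 _ (fun t => t = u \/ t = v)) => //.
  exact: smallU (small1 _ u) (small1 _ v).
move=> z; rewrite ev_or !ev_eqv /= leUx; apply/andP; split; apply: Sup_ub => //.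
  by exists u; [left | rewrite eqvC].
by exists v; [right | rewrite eqvC].
Qed.

(** A subset [z] of [x] equals the name on the domain of [x] giving each
    element its membership value in [z]. *)
Lemma force_powerset h e : h <= ev e (Powerset name).
Proof.
apply/force_all => x.
apply: (@force_comprehension _ 1 2 _ (fun t =>
  forall u, name_dom t u -> name_dom x u)) => //.
  exact: name_powerset_small Asmall (name_dom_small x).
move=> z; set H := ev _ _; have /force_allin/= := lexx H => /(_ isT) zx.
have [||t tP] := @name_exists _ _ code code_inj (fun u a =>
  name_dom x u /\ a = isin u z).
- by move=> u a b [_ ->] [_ ->].
- by apply: small_sub (name_dom_small x) => u [a []].
apply: le_trans (Sup_ub Acomplete _); last first.
  by exists t; [move=> u [a /tP[]] | reflexivity].
apply/force_eqv; split=> u a k; first by move=> /tP[_ ->].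
move=> zu kH ka; have kuz := force_mem_dom zu ka; have := zx u k kH kuz.
rewrite ev_elem /= => kux; apply: (force_mem_elim kux) => v b l xv lk lb lvu.
restrict lk; apply: (@force_mem_intro _ _ _ v (isin v z)) => //.
  by apply/tP; split=> //; exists b.
by apply: force_mem_eqvl kuz; apply: force_eqv_sym.
Qed.

Lemma force_separation h e (x w z : nat) p : uniq [:: x; w; z] -> ~~ free w p ->
  h <= ev e (Separation x w z p).
Proof.
rewrite /= !inE !negb_or => /and3P[/andP[xw xz] wz _] wp; apply/force_all => u.
apply: (@force_comprehension _ w z _ (name_dom u)) => //.
- by rewrite /= !negb_or wz eq_sym xw.
- exact: name_dom_small.
move=> v; rewrite ev_and ev_elem /= updE /upd (negPf xz) eqxx.
apply: le_trans (leIl _ _) _;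
  apply: (force_mem_elim (lexx _)) => t a k ut _ _ kt.
by apply: le_trans kt (Sup_ub Acomplete _); exists t => //; exists a.
Qed.

Lemma force_empty_set h e : h <= ev e (EmptySet name).
Proof.
have [s _] := ZFC_infinity V.
apply: (@force_comprehension _ 0 1 _ (fun _ => False)) => //; first by exists s.
by move=> u; rewrite ev_absurd le0x.
Qed.

Lemma force_union h e : h <= ev e (Union name).
Proof.
apply/force_all => x.
apply: (@force_comprehension _ 1 2 _ (fun t =>
  exists2 y, name_dom x y & name_dom y t)) => //.
  apply: (small_bigcup (@name_val_inj _ _ code) (name_dom_small x)) => y _.
  exact: name_dom_small.
move=> z; apply: (force_ex_elim (lexx _)) => y k _;
  rewrite ev_and !ev_elem /= lexI.
rewrite /upd /= => /andP[kyx kzy].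
apply: (force_mem_elim kyx) => y' a l xy' lk _ yy'; restrict lk.
apply: (force_mem_elim (force_mem_eqvr (force_eqv_sym yy') kzy)) =>
  t b m y't ml _ mt.
apply: le_trans mt (Sup_ub Acomplete _); exists t => //.
by exists y'; [exists a | exists b].
Qed.

(** For each value of [y], the truth values of [p], for [z] ranging over all
    names, form a subset of the set [A]; so one witness per element of the
    domain of [x] and per truth value suffices. *)
Lemma force_collection h e (x y z w : nat) p : uniq [:: x; y; z; w] ->
  ~~ free w p -> h <= ev e (Collection x y z w p).
Proof.
rewrite /= !inE !negb_or => /and4P[/and3P[xy xz xw] /andP[yz yw] zw _] wp.
apply/force_all => X; set e1 := upd e x X; apply/force_imp => k _.
have e1x : e1 x = X by apply: updE.
have yx : y != x by rewrite eq_sym.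
rewrite (@force_allin _ _ _ (Var x) _ yx) /= e1x => H.
(* [g (Y, a)] realizes the value [a] of [p] at [Y], if any name does. *)
have /choice[g gP] (i : name * A) : exists Z,
    (exists Z', ev (upd (upd e1 y i.1) z Z') p = i.2) ->
    ev (upd (upd e1 y i.1) z Z) p = i.2.
  have [[Z ZP]|noZ] := pselect (exists Z',
    ev (upd (upd e1 y i.1) z Z') p = i.2).
    by exists Z.
  by exists X => /noZ.
have [|W WP] := @name_of_set (fun Z =>
  exists2 Y, name_dom X Y & exists2 a, True & Z = g (Y, a)).
  apply: (small_bigcup (@name_val_inj _ _ code) (name_dom_small X)) => Y _.
  by apply: (small_bigcup code_inj Asmall) => a _; apply: small1.
apply: (force_ex_intro (u := W)); rewrite (@force_allin _ _ _ (Var x) _ yx) /=.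
move=> Y l lk; rewrite {1}/upd (negPf xw) e1x => lY.
apply: (force_mem_elim lY) => Y' b m XY' ml mb Y'Y.
apply: (force_leibniz Y'Y).
have mY' : m <= isin Y' X by apply: force_mem_dom XY' mb.
apply: (force_ex_elim (H Y' m (le_trans ml lk) mY')) => Z n nm nZ.
pose a := ev (upd (upd e1 y Y') z Z) p.
apply: (@force_exin_intro _ _ _ _ _ (g (Y', a))) => //=.
  rewrite {1}/upd (eq_sym w y) (negPf yw) updE WP.
  apply: le_trans (lex1 _) _; rewrite -(eqv_refl (g (Y', a))).
  by apply: Sup_ub => //; exists (g (Y', a)) => //; exists Y';
    [exists b | exists a].
have ga : ev (upd (upd e1 y Y') z (g (Y', a))) p = a by apply: (gP (Y', a));
  exists Z.
suff -> : ev (upd (upd (upd e1 w W) y Y') z (g (Y', a))) p = a by [].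
apply: etrans ga; apply: ev_ext => i ip; rewrite /upd.
case: (i == z) => //; case: (i == y) => //.
by case: (eqVneq i w) => // iw; rewrite -iw ip in wp.
Qed.

(** Induction on names: an element of [u] is, piecewise, equal to a name in the
    domain of [u], so the Leibniz law carries the induction hypothesis to it. *)
Lemma force_regularity h e (x y : nat) p : x != y -> ~~ free y p ->
  free_for y x p -> h <= ev e (Regularity x y p).
Proof.
move=> xy yp fp; apply/force_imp => k _ /force_all H; apply/force_all.
elim/(@name_ind V A code) => u IH; have /force_imp := H u; apply => //.
apply/force_allin => [|v l lk]; first by rewrite /= eq_sym.
rewrite /= updE => lv.
have -> : ev (upd (upd e x u) y v) (subst x (Var y) p) = ev (upd e x v) p.
  rewrite ev_subst_var // updE; apply: ev_ext => n np; rewrite /upd.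
  case: eqP => // _; case: eqP => // ny.
  by rewrite -ny np in yp.
apply: (force_mem_elim lv) => t a m ut ml _ mt; apply: (force_leibniz mt).
exact: le_trans (le_trans ml lk) (IH t a ut).
Qed.

(** Replacement along the numerals of the model. *)
Lemma numerals_small : small (fun t : name => sval t)
  (fun t => exists n, t = iter n succ_name empty_name).
Proof.
have [c [c_inj cs]] := small_nat V.
apply: small_sub (small_image (fun t : name => sval t) (fun n =>
  iter n succ_name empty_name) c_inj cs).
by move=> t [n ->]; exists n.
Qed.

Lemma force_infinity h e : h <= ev e (Infinity name).
Proof.
have [W WP] := name_of_set numerals_small.
have memW n : h <= isin (iter n succ_name empty_name) W.
  rewrite WP; apply: le_trans (force_eqv_refl _ _) (Sup_ub Acomplete _).
  by exists (iter n succ_name empty_name) => //; exists n.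
apply: (force_ex_intro (u := W)); apply/force_and; split.
  apply: (force_ex_intro (u := empty_name)); apply/force_and; split.
    by rewrite ev_EmptyF //= updE force_eqv_refl.
  by rewrite ev_elem /=; apply: (memW 0).
apply/force_allin => //= v k kh; rewrite {1}/upd /= WP => kv.
apply: (force_Sup_elim Acomplete kv) => l _ [t [n ->] ->] lk lv.
apply: (force_leibniz lv).
apply: (force_ex_intro (u := iter n.+1 succ_name empty_name)).
rewrite ev_and ev_SuccF // ev_elem /upd /= lexI force_eqv_refl.
exact: le_trans (le_trans lk kh) (memW n.+1).
Qed.

(** ** Choice *)

Section ChoiceFunction.
Variables (lt : name -> name -> Prop) (D : name -> Prop).
Hypothesis lt_total : forall s t, s <> t -> lt s t \/ lt t s.
Hypothesis lt_wf : forall Q : name -> Prop, (exists t, Q t) ->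
  exists2 t, Q t & forall s, lt s t -> ~ Q s.

(** The second disjunct admits every [t] as a value of the choice function at
    the empty set, so that its domain is the whole given set. *)
Definition candidate x t := isin t x `|` eqv x empty_name.

Definition earlier_candidate x t :=
  Sup (fun b => exists s, [/\ D s, lt s t & b = candidate x s]).

(** The degree to which [t] is the value of the choice function at [x]. *)
Definition first_candidate x t := candidate x t `&` ~` earlier_candidate x t.

Lemma candidate_extensional t : extensional_map (candidate ^~ t).
Proof.
move=> h x y xy; rewrite /candidate => hx;
  apply: (force_or_elim hx) => k kh kx; restrict kh.
  by apply: lexUl; apply: force_mem_eqvr kx.
by apply: lexUr; apply: force_eqv_trans kx; apply: force_eqv_sym.
Qed.

Lemma first_candidate_extensional t : extensional_map (first_candidate ^~ t).
Proof.
move=> h x y xy; rewrite /first_candidate !lexI => /andP[hx hnx].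
rewrite (candidate_extensional xy hx) /= -disj_leC -lex0 meetC.
apply: (force_Sup_elim Acomplete (leIl _ _)) => k _ [s [Ds st ->]].
rewrite lexI => /andP[_ kh] ks; restrict kh.
apply: (@force_absurd _ _ _ (earlier_candidate x t)) => //.
apply: le_trans (candidate_extensional (force_eqv_sym xy) ks) _.
by apply: Sup_ub => //; exists s.
Qed.

Lemma first_candidate_unique h x s t c : D s -> D t -> s <> t ->
  h <= first_candidate x s -> h <= first_candidate x t -> h <= c.
Proof.
move=> Ds Dt st; rewrite !lexI => /andP[hs hns] /andP[ht hnt].
have [lst|lts] := lt_total st.
  apply: force_absurd hnt; apply: le_trans hs _.
  by apply: Sup_ub => //; exists s.
apply: force_absurd hns; apply: le_trans ht _.
by apply: Sup_ub => //; exists t.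
Qed.

(** Let [t] be the least counterexample. Where there is an earlier candidate,
    that one lies below the supremum; elsewhere [t] itself is the first. *)
Lemma candidate_le_first x t : D t ->
  candidate x t <= Sup (fun b => exists2 s, D s & b = first_candidate x s).
Proof.
set S := Sup _ => Dt; apply: contrapT => nt.
have [|{nt Dt}t [Dt nt] tmin] := @lt_wf (fun t => D t /\ ~ candidate x t <= S).
  by exists t.
apply: nt; apply: (@force_compl_elim _ _ _ (earlier_candidate x t)) => k kt kE.
  apply: le_trans kE _; apply: Sup_least => // _ [s [Ds st ->]].
  by apply: contrapT => ns; apply: (tmin s st).
apply: (@le_trans _ _ (first_candidate x t)); first by rewrite lexI kt.
by apply: Sup_ub => //; exists t.
Qed.

End ChoiceFunction.

(** Cases on the supremum of the membership values of the names in the domain of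
    [x]; its complement forces [x] to be empty. *)
Lemma nonempty_or_empty x h c :
  (forall t a k, name_maps x t a -> k <= h -> k <= isin t x -> k <= c) ->
  (forall k, k <= h -> k <= eqv x empty_name -> k <= c) -> h <= c.
Proof.
move=> Hne He; pose s := Sup (fun b => exists2 t, name_dom x t & b = isin t x).
apply: (@force_compl_elim _ _ _ s) => k kh ks.
  apply: (force_Sup_elim Acomplete ks) => l _ [t [a xt] ->] lk.
  exact: Hne xt (le_trans lk kh).
apply: (He _ kh); apply/force_eqv; split=> t a l xt lk la.
  apply: (@force_absurd _ _ _ s); last exact: le_trans ks.
  apply: le_trans (force_mem_dom xt la) (Sup_ub Acomplete _).
  by exists t => //; exists a.
by have := force_mem_dom xt la; rewrite mem_empty => /le_trans; apply;
  apply: le0x.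
Qed.

(** The choice function on [u] relates [x] to its first candidate. Candidates
    are drawn from the domains of the names in the domain of [u], and are
    compared in an external well-order of all names. *)
Lemma choice_function_exists u : exists f,
  [/\ forall h z c, h <= isin z f ->
        (forall k x y, k <= h -> k <= eqv z (opair x y) -> k <= c) -> h <= c,
      forall h x y y', h <= isin (opair x y) f -> h <= isin (opair x y') f ->
        h <= eqv y y',
      forall h x y, h <= isin (opair x y) f -> h <= isin x u &
      forall h x c, h <= isin x u ->
        (forall k y, k <= h -> k <= isin (opair x y) f ->
          k <= candidate x y -> k <= c) ->
        h <= c].
Proof.
have [lt [lt_total lt_wf]] := well_order_exists name.
pose D t := (exists2 x, name_dom u x & name_dom x t) \/ t = empty_name.
pose first_in := first_candidate lt D.
have Ds : name_small D.
  apply: smallU (small1 _ _).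
  apply: (small_bigcup (@name_val_inj _ _ code) (name_dom_small u)) => x _.
  exact: name_dom_small.
have [|f fP] := @name_of_values (fun z a => exists x b t,
    [/\ name_maps u x b, D t, z = opair x t & a = b `&` first_in x t]).
  apply: (@small_sub _ _ _ _ (fun z =>
    exists2 x, name_dom u x & exists2 t, D t & z = opair x t)).
    by move=> z [a [x [b [t [ux Dt -> _]]]]]; exists x; [exists b | exists t].
  apply: (small_bigcup (@name_val_inj _ _ code) (name_dom_small u)) => x _.
  exact: small_image (@name_val_inj _ _ code) Ds.
have f_elim h z c : h <= isin z f ->
    (forall k x b t, name_maps u x b -> D t -> k <= h -> k <= b ->
      k <= first_in x t ->
      k <= eqv (opair x t) z -> k <= c) -> h <= c.
  rewrite fP => hz H; apply: (force_Sup_elim Acomplete hz).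
  move=> k _ [_ [_ [[x [b [t [ux Dt -> ->]]]] ->]]] kh.
  by rewrite lexI lexI -andbA => /and3P[kb kt kz]; exact: (H k x b t).
exists f; split.
- move=> h z c hz H; apply: (f_elim _ _ _ hz) => k x b t _ _ kh _ _ kz.
  by apply: (H k x t kh); apply: force_eqv_sym.
- move=> h x y y' hy hy'; apply: (f_elim _ _ _ hy) =>
  k x1 b1 t1 _ Dt1 kh _ k1 /force_opair_inj[x1x t1y].
  restrict kh; apply: (f_elim _ _ _ hy') =>
    l x2 b2 t2 _ Dt2 lk _ l2 /force_opair_inj[x2x t2y'].
  restrict lk; have [t12|t12] := pselect (t1 = t2).
    by rewrite -t12 in t2y'; apply: force_eqv_trans (force_eqv_sym t1y) t2y'.
  (* Two distinct names are never first candidates at one element. *)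
  have l1 := first_candidate_extensional x1x k1.
  have l2' := first_candidate_extensional x2x l2.
  exact: (first_candidate_unique lt_total _ Dt1 Dt2 t12 l1 l2').
- move=> h x y hxy; apply: (f_elim _ _ _ hxy) =>
  k x1 b t ux1 _ kh kb _ /force_opair_inj[x1x _].
  exact: force_mem_intro ux1 kb x1x.
- move=> h x c hx H; apply: (force_mem_elim hx) => x1 b k ux1 kh kb x1x.
  have step t l : D t -> l <= k -> l <= candidate x1 t -> l <= c.
    move=> Dt lk lt1; restrict lk.
    have := le_trans lt1 (candidate_le_first lt_wf x1 Dt) => lS.
    apply: (force_Sup_elim Acomplete lS) => m _ [s Dss ->] ml ms; restrict ml.
    have ms' : m <= candidate x s.
      by apply: candidate_extensional x1x _; move: ms; rewrite lexI => /andP[].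
    apply: (H m s) => //; rewrite fP; apply: le_trans (Sup_ub Acomplete _);
      last first.
      exists (opair x1 s), (b `&` first_in x1 s); split; last reflexivity.
      by exists x1, b, s.
    by rewrite lexI lexI kb ms force_opair_cong // force_eqv_refl.
  apply: (@nonempty_or_empty x1) => [t a l x1t lk lt1|l lk lx1].
    apply: (step t) => //; last exact: lexUl.
    by left; exists x1; [exists b | exists a].
  by apply: (step empty_name) => //; [right | apply: lexUr].
Qed.

Lemma force_choice h e : h <= ev e (ACSentence name).
Proof.
apply/force_all => u; have [f [fpair ffun fdom ftotal]] :=
  choice_function_exists u.
apply: (force_ex_intro (u := f)).
apply/force_and; split; last (apply/force_and; split).
- apply/force_and; split.
    apply/force_allin => //= z k _; rewrite {1}/upd /= => kz.
    apply: (fpair _ _ _ kz) => l x y _ lz.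
    apply: (force_ex_intro (u := x)); apply: (force_ex_intro (u := y)).
    by rewrite ev_OPairF.
  apply/force_all => x; apply/force_all => y; apply/force_all => y'.
  apply/force_imp => k _; rewrite ev_and !ev_AppF // ev_eqv lexI /upd /= =>
    /andP[].
  exact: ffun.
- apply: (force_ex_intro (u := u)); apply/force_and; split; last first.
    by rewrite ev_eqv /upd /= force_eqv_refl.
  apply/force_all => x; apply/force_iff => k _; rewrite ev_elem /upd /=;
    split=> H.
    apply: (ftotal _ _ _ H) => l y _ ly _; apply: (force_ex_intro (u := y)).
    by rewrite ev_AppF.
  apply: (force_ex_elim H) => y l _; rewrite ev_AppF // /upd /=; exact: fdom.
- apply/force_allin => //= x k _; rewrite {1}/upd /= => kx.
  apply/force_imp => l lk lne.
  apply: (ftotal _ _ _ (le_trans lk kx)) => m y ml my mc; restrict ml.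
  apply: (force_ex_intro (u := y));
    rewrite ev_and ev_AppF // ev_elem /upd /= lexI my /=.
  apply: (force_or_elim mc) => // n nm nx; restrict nm.
  move: lne; rewrite ev_imp ev_bot => /force_bimp/(_ n (lexx n)) H.
  apply: le_trans (le0x _); apply: H; apply: (force_ex_intro (u := empty_name)).
  by rewrite ev_and ev_EmptyF // ev_eqv /upd /= lexI force_eqv_refl.
Qed.

Lemma valid_axiom e p : ZF_axiom p -> \top <= ev e p.
Proof.
case=> [||ns x y z w q uni wq _||ns x w z q uni wq _||||ns x y q xy yq fq _].
- exact: force_extensionality.
- exact: force_pairing.
- by apply: force_foralls => e'; apply: force_collection.
- exact: force_powerset.
- by apply: force_foralls => e'; apply: force_separation.
- exact: force_empty_set.
- exact: force_union.
- exact: force_infinity.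
- by apply: force_foralls => e'; apply: force_regularity.
Qed.

End Forcing.

Theorem theorem5p9 (V : ZFC_model) (d : Order.disp_t)
    (A : ctbDistrLatticeType d) (Acomplete : complete A)
    (code : A -> V) (Acoded : set_coding code)
    (N : A -> set A) (AN : C2omega_structure N)
    (I : formula (name code) -> A) (I_int : interpretation N I) :
  (forall phi, ZF_axiom phi -> valid I phi) /\ valid I (ACSentence (name code)).
Proof.
have [code_inj [s sP]] := Acoded.
have Asmall : small code (fun _ => True) by exists s => a _; apply/sP; exists a.
(* The value of a sentence is that at any assignment. *)
have e0 : nat -> name code := fun _ => empty_name Acomplete code_inj I_int.
have closed phi : sentence phi -> \top <= ev I e0 phi -> valid I phi.
  by rewrite /valid le1x => /(ev_sentence I e0)-> /eqP.
(* The variables of the single axioms are below 27; they have no free variable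
   by computation at 0, ..., 26 and, uniformly, at all larger numbers. *)
split=> [phi axphi|]; apply: closed.
- by case: axphi => //; rewrite /sentence; do 27!(case=> //).
- exact: (valid_axiom Acomplete code_inj I_int Asmall).
- by rewrite /sentence; do 27!(case=> //).
- exact: (force_choice Acomplete code_inj I_int).
Qed.
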